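(* Let $\kappa$ be an infinite cardinal and $n\in\omega$. If $\square_{\kappa^{+m}}(\sqsubseteq_{\mathrm{cf}(\kappa)})$ holds for every $m<n$, then there exists a special $(n+1,\kappa)$-semiladder of cardinality $\kappa^{+n}$.
   Context: For infinite cardinals $\chi\le\lambda$, $\square_{\lambda}(\sqsubseteq_{\chi})$ asserts: there is a sequence $\langle C_\alpha \mid \alpha<\lambda^+,\ \mathrm{cf}(\alpha)\ge\chi\rangle$ with (i) $C_\alpha$ closed unbounded in $\alpha$; (ii) $\mathrm{otp}(C_\alpha)\le\lambda$; (iii) if $\beta$ is a limit point of $C_\alpha$ with $\mathrm{cf}(\beta)\ge\chi$ then $C_\beta=C_\alpha\cap\beta$. For a set $X$, $\overline{X}^{\top}$ is the join-semilattice on $X\sqcup\{\mathbf 1\}$ with $x\vee y=\mathbf 1$ for all distinct $x,y$; $\overline{k}^{\top}$ is this for $X=\{0,\dots,k-1\}$. A join-semilattice is $\overline{k}^{\top}$-free if it has no join-subsemilattice isomorphic to $\overline{k}^{\top}$. An $(m,\kappa)$-semiladder is a nonempty join-semilattice that is $\overline{(m+1)}^{\top}$-free with all principal ideals of cardinality $<\kappa$; an $(m,\kappa)$-ladder is such a structure that is a lattice. Given a join-semilattice $B$ with least element $\mathbf 0_B$, an ordinal $\gamma$, and a map $\varrho:[\gamma]^2\to B$ (writing $\varrho(\alpha,\beta)$ for $\varrho(\{\alpha,\beta\})$ and setting $\varrho(\alpha,\alpha)=\mathbf 0_B$), define the relation $\trianglelefteq_\varrho$ on $\gamma\times B$ by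 $(\alpha,p)\trianglelefteq_\varrho(\beta,q)$ iff $\alpha\le\beta$ and $p\vee\varrho(\alpha,\beta)\le q$. Special (semi)ladders are defined recursively: a special $(0,\kappa)$-semiladder is the trivial join-semilattice $\{\mathbf 0\}$; for a positive integer $n$, an $(n,\kappa)$-(semi)ladder $S$ is special if $S=(\gamma\times B,\trianglelefteq_\varrho)$ for some ordinal $\gamma$, some special $(n-1,\kappa)$-(semi)ladder $B$, and some $\varrho:[\gamma]^2\to B$ with $\varrho(0,\alpha)=\mathbf 0_B$ for all $\alpha<\gamma$. *)

(* Defs.v *)
From HB Require Import structures.
From mathcomp Require Import all_boot all_order.
From mathcomp Require Import boolp classical_sets functions cardinality wochoice.

Set SsrOldRewriteGoalsOrder.
Set Implicit Arguments.
Unset Strict Implicit.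
Unset Printing Implicit Defensive.

Import Order.TTheory.
Local Open Scope classical_set_scope.
Local Open Scope card_scope.
Local Open Scope order_scope.

(* Ordinals are represented by well-ordered types, considered up to order
   isomorphism: an ordinal gamma is the well-ordered type of the ordinals below
   gamma, and the elements of gamma are its points. *)
Record woType : Type := WoType {
  wo_disp : Order.disp_t;
  wo_sort :> orderType wo_disp;
  wo_wellP : well_order (<=%O : rel wo_sort) }.

Lemma wo_min (W : woType) (A : set W) :
  A !=set0 -> exists2 x, A x & forall y, A y -> x <= y.
Proof.
move=> [a Aa]; have [|z [[zA zmin] _]] := @wo_wellP W (mem A).
  by exists a; apply/mem_set.
by exists z; [apply: set_mem | move=> y Ay; apply/zmin/mem_set].
Qed.

Lemma wo_ind (W : woType) (P : W -> Prop) :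
  (forall x, (forall y, y < x -> P y) -> P x) -> forall x, P x.
Proof.
move=> IH x; apply: contrapT => nPx.
have [|z nPz zmin] := @wo_min W [set y | ~ P y]; first by exists x.
apply: nPz; apply: IH => y yz; apply: contrapT => nPy.
by have := zmin y nPy; rewrite leNgt yz.
Qed.

Definition wo_le (V W : woType) : Prop :=
  exists f : V -> W, {mono f : x y / x <= y} /\
    forall x y, y <= f x -> range f y.

Definition below (W : woType) (a : W) : set W := [set x | x < a].

Section OrderType.
Variables (W : woType) (A : set W).

Definition otp_sort : Type := set_type A.

HB.instance Definition _ := SubChoice.on otp_sort.
HB.instance Definition _ :=
  [SubChoice_isSubOrder of otp_sort by <: with wo_disp W].

Lemma otp_well_order : well_order (<=%O : rel otp_sort).
Proof.
apply: antisymmetric_well_order => [|D [a aD]]; first exact: le_anti.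
have [|z [u uD <-] zmin] := @wo_min W [set val u | u in [set u | u \in D]].
  by exists (val a), a.
by exists u; split=> // v vD; rewrite -Order.le_val; apply: zmin; exists v.
Qed.

Definition otp : woType := WoType otp_well_order.

Lemma otp_leE (u v : otp) : (u <= v) = (val u <= val v).
Proof. by []. Qed.

Lemma otp_ltE (u v : otp) : (u < v) = (val u < val v).
Proof. by rewrite !lt_neqAle. Qed.

Lemma otpP (u : otp) : A (val u).
Proof. exact: set_mem (valP u). Qed.

End OrderType.

Section Comparison.
Variables V W : woType.

Inductive wo_match (x : V) (y : W) : Prop := WoMatch of
  (forall x', x' < x -> exists2 y', y' < y & wo_match x' y') &
  (forall y', y' < y -> exists2 x', x' < x & wo_match x' y').

Lemma wo_match_fun x y y' : wo_match x y -> wo_match x y' -> y = y'.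
Proof.
elim/wo_ind: x y y' => x IH.
suff H y y' : wo_match x y -> wo_match x y' -> ~ (y < y').
  move=> y y' m m'; case: (ltgtP y y') => [h|h|//].
    by case: (H _ _ m m').
  by case: (H _ _ m' m).
move=> [m _] [_ m'] /m'[x' x'x x'y]; have [y2 y2y x'y2] := m _ x'x.
by move: y2y; rewrite (IH x' x'x y2 y) // ltxx.
Qed.

Lemma wo_match_inj x x' y : wo_match x y -> wo_match x' y -> x = x'.
Proof.
elim/wo_ind: y x x' => y IH.
suff H x x' : wo_match x y -> wo_match x' y -> ~ (x < x').
  move=> x x' m m'; case: (ltgtP x x') => [h|h|//].
    by case: (H _ _ m m').
  by case: (H _ _ m' m).
move=> [_ m] [m' _] /m'[y' y'y xy']; have [x2 x2x x2y'] := m _ y'y.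
by move: x2x; rewrite (IH y' y'y x2 x) // ltxx.
Qed.

Lemma wo_match_lt x x' y y' : wo_match x y -> wo_match x' y' ->
  (x < x') = (y < y').
Proof.
move=> m m'; apply/idP/idP => h.
  by case: (m') => /(_ _ h)[y2 y2y' /(wo_match_fun m) ->].
by case: (m') => _ /(_ _ h)[x2 x2x' /(wo_match_inj m) ->].
Qed.

Lemma wo_match_le x x' y y' : wo_match x y -> wo_match x' y' ->
  (x <= x') = (y <= y').
Proof. by move=> m m'; rewrite !leNgt (wo_match_lt m' m). Qed.

Lemma wo_total : wo_le V W \/
  exists x (g : W -> V), {mono g : y z / y <= z} /\ range g = below x.
Proof.
have [dom|/existsNP ndom] := pselect (forall x, exists y, wo_match x y).
  have [f fP] := choice dom; left; exists f; split=> [x x'|x y yfx].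
    by rewrite (wo_match_le (fP x) (fP x')).
  move: yfx; rewrite le_eqVlt => /orP[/eqP-> //|yfx].
  by case: (fP x) => _ /(_ _ yfx)[x' _ /(wo_match_fun (fP x')) <-]; exists x'.
have [x /= nx xmin] := wo_min ndom.
have domlt x' : x' < x -> exists y, wo_match x' y.
  by move=> x'x; apply: contrapT => /xmin; rewrite leNgt x'x.
have [ran|/existsNP nran] := pselect (forall y, exists x, wo_match x y); last first.
  have [y ny ymin] := wo_min nran; case: (nx); exists y; split=> [x' x'x|y' y'y].
    have [y' m] := domlt _ x'x; exists y' => //; rewrite ltNge; apply/negP => yy'.
    move: yy'; rewrite le_eqVlt => /orP[/eqP yy'|yy'].
      by apply: ny; exists x'; rewrite yy'.
    by case: m => _ /(_ _ yy')[x2 _ m2]; apply: ny; exists x2.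
  have [x' m] : exists x', wo_match x' y'.
    by apply: contrapT => /ymin; rewrite leNgt y'y.
  exists x' => //; rewrite ltNge; apply/negP.
  rewrite le_eqVlt => /orP[/eqP xx'|xx']; first by apply: nx; exists y'; rewrite xx'.
  by case: m => /(_ _ xx')[y2 _ m2] _; apply: nx; exists y2.
have [g gP] := choice ran; right; exists x, g; split=> [y z|].
  by rewrite (wo_match_le (gP y) (gP z)).
apply/seteqP; split=> [_ [y _ <-]|x' /domlt[y m]]; last first.
  by exists y => //; apply: wo_match_inj (gP y) m.
rewrite /below /mkset ltNge; apply/negP.
rewrite le_eqVlt => /orP[/eqP xg|xg]; first by apply: nx; exists y; rewrite xg.
by case: (gP y) => /(_ _ xg)[y2 _ m2] _; apply: nx; exists y2.
Qed.

End Comparison.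

Lemma wo_le_trans (U V W : woType) : wo_le V U -> wo_le U W -> wo_le V W.
Proof.
move=> [f [fm fi]] [g [gm gi]]; exists (g \o f); split=> [x y|x y /= ygf].
  by rewrite /= gm fm.
have [u _ uy] := gi _ _ ygf; move: ygf; rewrite -uy gm => /fi[v _ <-].
by exists v.
Qed.

Lemma wo_le_below (U V W : woType) (f : U -> W) (g : V -> W) (x y : W) :
  {mono f : a b / a <= b} -> {mono g : a b / a <= b} ->
  range f = below x -> range g = below y -> x <= y -> wo_le U V.
Proof.
move=> fm gm rf rg xy.
have /choice[h hP] : forall u, exists v, g v = f u.
  move=> u; have : below y (f u).
    by apply: lt_le_trans xy; have : range f (f u); [exists u | rewrite rf].
  by rewrite -rg => -[v _]; exists v.
exists h; split=> [u u'|u v vhu]; first by rewrite -gm !hP fm.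
have : below x (g v).
  apply: (@le_lt_trans _ _ (f u)); first by rewrite -hP gm.
  by have : range f (f u); [exists u | rewrite rf].
rewrite -rf => -[u' _ fu']; exists u' => //; apply: le_anti.
by rewrite -!gm hP fu' lexx.
Qed.

Lemma wo_minimal (I : Type) (P : I -> Prop) (F : I -> woType) :
  (exists i, P i) -> exists2 i, P i & forall j, P j -> wo_le (F i) (F j).
Proof.
move=> [i0 Pi0]; have [m|/existsNP[j0 /not_implyP[Pj0 nle]]] :=
  pselect (forall j, P j -> wo_le (F i0) (F j)); first by exists i0.
pose D := [set x : F i0 | exists j (g : F j -> F i0),
  [/\ P j, {mono g : a b / a <= b} & range g = below x]].
have [|x [i [f [Pi fm rf]]] xmin] := @wo_min _ D.
  have [//|[x [g [gm rg]]]] := wo_total (F i0) (F j0).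
  by exists x, j0, g.
exists i => // j Pj; have [le0|[y [g [gm rg]]]] := wo_total (F i0) (F j).
  apply: wo_le_trans le0; exists f; split=> // u y yfu.
  rewrite rf; apply: le_lt_trans yfu _.
  by have : range f (f u); [exists u | rewrite rf].
by apply: (wo_le_below fm gm rf rg); apply: xmin; exists j, g.
Qed.

Definition cofinal (W : woType) (A : set W) : Prop :=
  forall x, exists2 y, A y & x <= y.

(* The default value of xget is never used: see cof_spec below. *)
Definition cof (W : woType) : woType :=
  otp (xget setT [set A : set W | cofinal A /\
                    forall B : set W, cofinal B -> wo_le (otp A) (otp B)]).

Lemma cof_spec (W : woType) :
  (exists2 A : set W, cofinal A & cof W = otp A) /\
  forall B : set W, cofinal B -> wo_le (cof W) (otp B).
Proof.
have [|A Acof Amin] := @wo_minimal _ (@cofinal W) (@otp W).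
  by exists setT => x; exists x.
rewrite /cof; case: xgetP => [B _ [Bcof Bmin]|/(_ A) nA]; last by case: nA; split.
by split=> //; exists B.
Qed.

Definition card_lt (T U : Type) (A : set T) (B : set U) : Prop :=
  A #<= B /\ ~ (B #<= A).

(* Cardinals are initial ordinals. *)
Definition is_cardinal (W : woType) : Prop :=
  forall a : W, card_lt (below a) [set: W].

Definition infinite_cardinal (W : woType) : Prop :=
  is_cardinal W /\ infinite_set [set: W].

Section WellOrdering.
Variables (T : choiceType) (R : rel T) (Rwo : well_order R).

Let Rch : wo_chain R predT. Proof. exact: withinW Rwo. Qed.

Definition wo_by_sort of well_order R : Type := T.
Local Notation sort := (wo_by_sort Rwo).

Fact wo_by_refl : reflexive R.
Proof. by move=> x; apply: (wo_chain_reflexive Rch). Qed.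

Fact wo_by_total : total R.
Proof. by move=> x y; apply: (wo_chainW Rch). Qed.

Fact wo_by_anti : antisymmetric R.
Proof. by move=> x y; apply: (wo_chain_antisymmetric Rch). Qed.

Fact wo_by_trans : transitive R.
Proof.
move=> y x z Rxy Ryz.
have [|m [[mA mmin] _]] := Rwo (A := [pred w | [|| w == x, w == y | w == z]]).
  by exists x; rewrite inE eqxx.
have [Rmx Rmy Rmz] : [/\ R m x, R m y & R m z].
  by split; apply: mmin; rewrite inE eqxx ?orbT.
case/or3P: mA.
- by move/eqP <-.
- by move/eqP => my; rewrite (@wo_by_anti x y) // Rxy -my Rmx.
- by move/eqP => mz; rewrite -(@wo_by_anti y z) // Ryz -mz Rmy.
Qed.

HB.instance Definition _ := Choice.on sort.
HB.instance Definition _ := Order.Le_isPOrder.Build (Order.Disp tt tt) sort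
  wo_by_refl wo_by_anti wo_by_trans.
HB.instance Definition _ :=
  Order.POrder_isTotal.Build (Order.Disp tt tt) sort wo_by_total.

Definition wo_by : woType := @WoType _ sort Rwo.

End WellOrdering.

Definition powerset_wo (W : woType) : woType :=
  wo_by (projT2 (well_ordering_principle (set W))).

(* The successor cardinal (Hartogs number) of W: the initial segment of a
   well-ordering of the powerset of W made of the points with at most |W|
   predecessors. It does not depend on the well-ordering up to isomorphism; see
   succ_card_spec below. *)
Definition succ_card (W : woType) : woType :=
  otp [set x : powerset_wo W | below x #<= [set: W]].

Lemma inj_le_card (T U : Type) (A : set T) (B : set U) (f : T -> U) :
  (forall x, A x -> B (f x)) -> {in A &, injective f} -> A #<= B.
Proof.
move=> fAB finj; suff [g] : $|{injfun A >-> B}| by exact: inj_card_le g.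
by apply/injfunPex; exists f.
Qed.

Lemma Cantor (T : Type) : ~ ([set: set T] #<= [set: T]).
Proof.
move=> /pcard_surjP[g gsurj].
have [t _ gt] := gsurj [set x | ~ g x x] I.
have : g t t <-> ~ g t t by rewrite {1}gt.
by tauto.
Qed.

Lemma succ_card_spec (W : woType) :
  ~ ([set: succ_card W] #<= [set: W]) /\
  forall x : succ_card W, below x #<= [set: W].
Proof.
set P := powerset_wo W; set A : set P := [set x : P | below x #<= [set: W]].
split=> [le_A|u]; last first.
  have Au : A (\val u) by exact: otpP.
  apply: card_le_trans Au; apply: (@inj_le_card _ _ _ _ val) => [v|? ? _ _].
    by move=> vu; rewrite /below /mkset -otp_ltE.
  exact: val_inj.
have {}le_A : A #<= [set: W].
  by rewrite -(card_le_eql (card_setT A)).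
have [AT|/existsNP nA] := pselect (forall x, A x).
  apply: (@Cantor W); apply: card_le_trans le_A.
  by apply: subset_card_le => x _; apply: AT.
have [z nAz zmin] := @wo_min P [set x | ~ A x] nA.
apply: nAz; apply: card_le_trans le_A; apply: subset_card_le => x xz.
apply: contrapT => nAx; have := zmin x nAx.
by rewrite leNgt; move/negP; apply.
Qed.

Section Square.
Variable L : woType.
Implicit Types (C : set L) (a : L).

Definition limit_point C a : Prop :=
  (exists x, x < a) /\
  forall x, x < a -> exists2 y, C y & x < y < a.

Definition club_in C a : Prop :=
  [/\ C `<=` below a,
      forall x, x < a -> exists2 y, C y & x <= y
    & forall b, b < a -> limit_point C b -> C b].

Definition cof_at a : woType := cof (otp (below a)).

End Square.

(* The values of C at the points of cofinality < chi are irrelevant. *)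
Definition square (lambda chi : woType) : Prop :=
  exists C : succ_card lambda -> set (succ_card lambda),
    forall a, wo_le chi (cof_at a) ->
      [/\ club_in (C a) a, wo_le (otp (C a)) lambda
        & forall b, limit_point (C a) b -> wo_le chi (cof_at b) ->
            C b = C a `&` below b].

Section FlatTop.
Variable X : choiceType.

(* X with a new top element None, in which distinct elements have join None. *)
Definition flat_top : Type := option X.

HB.instance Definition _ := Choice.on flat_top.

Definition flat_top_le (x y : flat_top) : bool := (x == y) || (y == None).
Definition flat_top_join (x y : flat_top) : flat_top :=
  if x == y then x else None.

Fact flat_top_le_refl : reflexive flat_top_le.
Proof. by move=> x; rewrite /flat_top_le eqxx. Qed.

Fact flat_top_le_anti : antisymmetric flat_top_le.
Proof.
move=> x y /andP[]; rewrite /flat_top_le => /orP[/eqP //|/eqP ->].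
by case/orP => /eqP.
Qed.

Fact flat_top_le_trans : transitive flat_top_le.
Proof.
move=> y x z; rewrite /flat_top_le => /orP[/eqP -> //|/eqP ->].
by case/orP => [/eqP <-|->]; rewrite ?eqxx orbT.
Qed.

HB.instance Definition _ := Order.Le_isPOrder.Build (Order.Disp tt tt) flat_top
  flat_top_le_refl flat_top_le_anti flat_top_le_trans.

Fact flat_top_joinC : commutative flat_top_join.
Proof. by move=> x y; rewrite /flat_top_join eq_sym; case: eqP. Qed.

Fact flat_top_joinA : associative flat_top_join.
Proof.
move=> x y z; rewrite /flat_top_join.
have [<-|yz] := eqVneq y z; have [xy|xy] := eqVneq x y => //.
- by rewrite xy eqxx.
- by case: ifP.
- by rewrite xy (negPf yz); case: eqP.
by case: eqP => [->|_]; case: ifP.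
Qed.

Fact flat_top_leEjoin (x y : flat_top) : (y <= x) = (flat_top_join x y == x).
Proof.
rewrite -[y <= x]/(flat_top_le y x) /flat_top_le /flat_top_join [y == x]eq_sym.
by have [->|_] := eqVneq x y; rewrite ?eqxx //= eq_sym.
Qed.

HB.instance Definition _ := Order.POrder_Join_isSemilattice.Build
  (Order.Disp tt tt) flat_top flat_top_joinC flat_top_joinA flat_top_leEjoin.

End FlatTop.

Definition flat_top_free (k : nat) d (S : joinSemilatticeType d) : Prop :=
  ~ exists f : flat_top 'I_k -> S,
      injective f /\ {morph f : x y / x `|` y}.

Definition semiladder (m : nat) (kappa : woType) d
    (S : joinSemilatticeType d) : Prop :=
  [/\ [set: S] !=set0, flat_top_free m.+1 S
    & forall x : S, card_lt [set y | y <= x] [set: kappa]].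

Section TriangleOrder.
Variables (gamma : woType) (d : Order.disp_t) (B : bJoinSemilatticeType d).

(* A map on unordered pairs, extended by \bot on the diagonal. *)
Definition pair_map (rho : gamma -> gamma -> B) : Prop :=
  (forall a b, rho a b = rho b a) /\ forall a, rho a a = \bot.

Definition tri_le (rho : gamma -> gamma -> B) (u v : gamma * B) : bool :=
  (u.1 <= v.1) && (u.2 `|` rho u.1 v.1 <= v.2).

Definition vanishes_at_0 (rho : gamma -> gamma -> B) : Prop :=
  forall z, (forall a, z <= a) -> forall a, rho z a = \bot.

End TriangleOrder.

(* As ordinals are taken up to isomorphism, so are special semiladders: f
   identifies S with (gamma * B, tri_le rho). *)
Fixpoint special_semiladder (n : nat) (kappa : woType) d
    (S : bJoinSemilatticeType d) {struct n} : Prop :=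
  match n with
  | 0 => forall x : S, x = \bot
  | n'.+1 => semiladder n'.+1 kappa S /\
      exists (gamma : woType) d' (B : bJoinSemilatticeType d')
             (rho : gamma -> gamma -> B) (f : S -> gamma * B),
        [/\ special_semiladder n' kappa B, pair_map rho, vanishes_at_0 rho,
            bijective f & forall x y : S, (x <= y) = tri_le rho (f x) (f y)]
  end.

(* Main.v *)
Require Import Defs.
From HB Require Import structures.
From mathcomp Require Import all_boot all_order.
From mathcomp Require Import boolp classical_sets functions cardinality wochoice.

(* The semiladder is built by iterating S |-> gamma x S, where gamma is the next
   successor cardinal. With this order on gamma x S, freeness from flat tops is
   automatic, and all that is needed is a map rho : [gamma]^2 -> S which is
   subadditive in both senses and such that {a < b | rho a b <= q} always has
   fewer than kappa elements. Subadditivity amounts to coherence: if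
   rho a b <= q and x <= a, then rho x a <= q iff rho x b <= q.
   The map is defined by recursion on b; call a set small if its cardinality is
   less than cf kappa. Small subsets of S are bounded, which is preserved by the
   construction. If cf b < cf kappa, take a small cofinal K in b, a bound p of rho
   on K, and put rho a b = p v rho a c for any c >= a in K. Otherwise let C be the
   club given by the square at b and put rho a b = e c v rho a c, where
   c = min (C \ a). Here e c depends only on c and on C n c: it lies above a label
   which is injective along C, so that few c have e c <= q, and above rho z c and
   e z for z in a small cofinal subset of C n c. When there is no such subset, c
   is a limit point of C of cofinality at least cf kappa, and there the square
   gives rho x c = e c' v rho x c' with c' = min (C \ x). Coherence is then proved
   by induction along C. *)

Set Implicit Arguments.
Unset Strict Implicit.
Unset Printing Implicit Defensive.

Import Order.TTheory.
Local Open Scope classical_set_scope.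
Local Open Scope card_scope.
Local Open Scope order_scope.
Local Notation cut X c := (X `&` below c)%classic.

(** * Cardinal arithmetic *)

Lemma card_le_fun (T U : Type) (A : set T) (B : set U) (u : U) :
  A #<= B -> exists f : T -> U,
    (forall x, A x -> B (f x)) /\ forall x y, A x -> A y -> f x = f y -> x = y.
Proof.
move=> /card_leP[f].
pose g x := if pselect (A x) is left Ax then val (f (SigSub (mem_set Ax))) else u.
exists g; split=> [x Ax|x y Ax Ay]; rewrite /g; case: pselect => // Ax'.
  exact/set_mem/(valP (f _)).
case: pselect => // Ay' /val_inj /inj => /(_ (mem_set I) (mem_set I)).
by move=> /(congr1 val).
Qed.

Lemma card_le_funT (T U : Type) (A : set T) :
  [set: U] #<= A -> exists2 f : U -> T, forall x, A (f x) & injective f.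
Proof.
have [[u _]|nU] := pselect (exists u : U, True); last first.
  move=> _; have f (u : U) : T by case: nU; exists u.
  by exists f => x; case: nU; exists x.
move=> leA; have [t At] : A !=set0.
  apply/set0P/eqP => A0; move: leA; rewrite A0 card_le0 => /eqP U0.
  by have : [set: U] u by []; rewrite U0.
have [f [fA finj]] := card_le_fun t leA.
by exists f => [x|x y]; [apply: fA | apply: finj].
Qed.

Lemma inj_on_le_card (T U : Type) (A : set T) (B : set U) (f : T -> U) :
  (forall x, A x -> B (f x)) ->
  (forall x y, A x -> A y -> f x = f y -> x = y) -> A #<= B.
Proof.
move=> fAB finj; apply: (inj_le_card fAB) => x y /set_mem Ax /set_mem Ay.
exact: finj.
Qed.

Lemma wo_le_card (V W : woType) : wo_le V W -> [set: V] #<= [set: W].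
Proof.
move=> [f [fm _]]; apply: (@inj_on_le_card _ _ _ _ f) => // x y _ _ fxy.
by apply: le_anti; rewrite -!fm fxy lexx.
Qed.

Lemma card_otp (W : woType) (A : set W) : [set: otp A] #= A.
Proof. exact: card_setT. Qed.

Lemma mono_card_below (V W : woType) (g : V -> W) x :
  {mono g : a b / a <= b} -> range g = below x -> [set: V] #= below x.
Proof.
move=> gm <-; rewrite card_eq_sym; apply: inj_card_eq => a b _ _ gab.
by apply: le_anti; rewrite -!gm gab lexx.
Qed.

Definition some_wo (T : choiceType) : woType :=
  wo_by (projT2 (well_ordering_principle T)).

(** Well-ordering both types reduces this to the comparability of order types. *)
Lemma card_le_total (T U : choiceType) (A : set T) (B : set U) :
  A #<= B \/ B #<= A.
Proof.
have AE := @card_otp (some_wo T) A; have BE := @card_otp (some_wo U) B.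
have [le|[x [g [gm rg]]]] := wo_total (@otp (some_wo T) A) (@otp (some_wo U) B).
  left; have := wo_le_card le.
  by rewrite (card_le_eql AE) (card_le_eqr BE).
right; have := mono_card_below gm rg => e.
have : [set: @otp (some_wo U) B] #<= [set: @otp (some_wo T) A].
  by rewrite (card_le_eql e); apply: card_leT.
by rewrite (card_le_eql BE) (card_le_eqr AE).
Qed.

(** Hilbert's hotel: along a copy of the natural numbers inside [A] every point moves up by one, and
    a new [x] takes place [0]. *)
Lemma card_le_setU1 (T : Type) (A : set T) (x : T) :
  infinite_set A -> (x |` A) #<= A.
Proof.
move=> /infiniteP/card_le_funT[i iA iinj].
have [Ax|nAx] := pselect (A x).
  by rewrite setUidr // => _ ->.
have /choice[f fP] : forall z, exists y, [\/ z = x /\ y = i 0,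
    exists2 n, z = i n & y = i n.+1 | [/\ z <> x, forall n, z <> i n & y = z]].
  move=> z; have [->|zx] := pselect (z = x); first by exists (i 0); apply: Or31.
  have [[n ->]|ni] := pselect (exists n, z = i n).
    by exists (i n.+1); apply: Or32; exists n.
  by exists z; apply: Or33; split=> // n zn; apply: ni; exists n.
apply: (@inj_on_le_card _ _ _ _ f) => [z zxA|z z' _ _].
  case: (fP z) => [[_ ->]|[n _ ->]|[zx _ ->]] //.
  by case: zxA.
case: (fP z) => [[-> ->]|[n -> ->]|[zx zi ->]];
  case: (fP z') => [[-> ->]|[n' -> ->]|[zx' zi' ->]] //.
- by move/iinj.
- by move/esym/zi'.
- by move/iinj.
- by move/iinj => [->].
- by move/esym/zi'.
- by move/zi.
- by move/zi.
Qed.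

Lemma card_le_setX (T U T' U' : Type) (A : set T) (B : set U) (A' : set T')
    (B' : set U') : A #<= A' -> B #<= B' -> A `*` B #<= A' `*` B'.
Proof.
have [->|/set0P[[t u] [/= At Bu]]] := eqVneq (A `*` B) set0.
  by move=> _ _; apply: card_ge0.
move=> leA leB.
have [a' _] : A' !=set0.
  apply/set0P/eqP => e; move: leA; rewrite e card_le0 => /eqP A0.
  by move: At; rewrite A0.
have [b' _] : B' !=set0.
  apply/set0P/eqP => e; move: leB; rewrite e card_le0 => /eqP A0.
  by move: Bu; rewrite A0.
have [f [fA finj]] := card_le_fun a' leA.
have [g [gA ginj]] := card_le_fun b' leB.
apply: (@inj_on_le_card _ _ _ _ (fun p => (f p.1, g p.2))) => [[a b] [/= Aa Bb]|].
  by split; [apply: fA | apply: gA].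
by move=> [a b] [c e] [/= Aa Bb] [/= Ac Be] [/finj -> // /ginj ->].
Qed.

Section MaxLex.
Variable W : woType.
Let top (p : W * W) := Order.max p.1 p.2.

(** Gödel's ordering of pairs: by maximum, then lexicographically. The predecessors of a pair lie in
    the square of the closed initial segment up to its maximum. *)
Definition maxlex (p q : W * W) : bool :=
  (top p < top q) || (top p == top q) &&
  ((p.1 < q.1) || (p.1 == q.1) && (p.2 <= q.2)).

Lemma maxlex_well_order : well_order maxlex.
Proof.
apply: antisymmetric_well_order => [[a b] [c e]|D [p pD]].
  rewrite /maxlex /=; case: ltgtP => //= _; case: ltgtP => //= -> be.
  by congr pair; apply: le_anti.
have [|_ [q qD <-] qmin] := @wo_min W [set top q | q in [set q | q \in D]].
  by exists (top p), p.
have [|_ [r [rD rq] <-] rmin] :=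
    @wo_min W [set r.1 | r in [set r | r \in D /\ top r = top q]].
  by exists q.1, q.
have [|_ [s [sD sq sr] <-] smin] :=
    @wo_min W [set s.2 | s in [set s | [/\ s \in D, top s = top q & s.1 = r.1]]].
  by exists r.2, r.
exists s; split=> // t tD; rewrite /maxlex sq sr.
have := qmin (top t); rewrite le_eqVlt => /(_ _)/predU1P[|qt|->//].
  by exists t.
rewrite qt ltxx eqxx /=.
have := rmin t.1; rewrite le_eqVlt => /(_ _)/predU1P[|rt|->//].
  by exists t.
rewrite rt ltxx eqxx /=; apply: smin; exists t => //.
Qed.

End MaxLex.

(** Hessenberg's theorem, by induction on [a]. If the square of [below a] is longer than [a] in
    Gödel's ordering, then [below a] is isomorphic to the predecessors of a pair with maximum
    [m < a]; hence |a| is at most |m + 1|^2, and the claim for [m] applies. *)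
Lemma card_below_sqr (W : woType) (a : W) :
  infinite_set (below a) -> below a `*` below a #<= below a.
Proof.
elim/wo_ind: a => a IH inf.
pose P := wo_by (@maxlex_well_order W).
pose A : set P := below a `*` below a.
have [le|[x [g [gm rg]]]] := wo_total (otp A) (otp (below a)).
  have := wo_le_card le; rewrite (card_le_eql (card_otp _)).
  by rewrite (card_le_eqr (card_otp _)).
have ax : below a #<= below x.
  rewrite -(card_le_eql (card_otp (below a))).
  by rewrite -(card_le_eqr (mono_card_below gm rg)).
pose m : W := Order.max (val x : W * W).1 (val x : W * W).2.
have ma : m < a by have [? ?] := otpP x; rewrite /m gt_max; apply/andP; split.
have xm : below x #<= (m |` below m) `*` (m |` below m).
  apply: (@inj_on_le_card _ _ _ _ (fun u => val u)) => [u ux|u v _ _];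
    last exact: val_inj.
  have h : maxlex (val u) (val x) by have /ltW := ux.
  have mE y : y <= m -> (m |` below m) y.
    by rewrite le_eqVlt => /predU1P[->|]; [left|right].
  rewrite /maxlex in h.
  have : Order.max (val u : W * W).1 (val u : W * W).2 <= m.
    by case/orP: h => [/ltW //|/andP[/eqP e _]]; rewrite e.
  by rewrite ge_max => /andP[? ?]; split; apply: mE.
have infm : infinite_set (below m).
  move=> fin; apply: inf.
  apply: (card_le_finite (card_le_trans ax xm)).
  by apply: finite_setX; rewrite finite_setU; split=> //; apply: finite_set1.
have mm := card_le_setU1 m infm.
have am : below a #<= below m.
  apply: (card_le_trans ax); apply: (card_le_trans xm).
  by apply: (card_le_trans (card_le_setX mm mm)); apply: IH.
apply: (card_le_trans (card_le_setX am am)); apply: (card_le_trans (IH _ ma infm)).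
by apply: subset_card_le => y /lt_trans; apply.
Qed.

(** Presents any well-order as an initial segment, the form required by [card_below_sqr]. *)
Lemma wo_card_below (W : woType) : exists x : succ_card W, [set: W] #= below x.
Proof.
have [le|[x [g [gm rg]]]] := wo_total (succ_card W) W.
  by case: (succ_card_spec W).1; apply: wo_le_card.
by exists x; apply: mono_card_below gm rg.
Qed.

Lemma card_sqr (T : choiceType) (A : set T) : infinite_set A -> A `*` A #<= A.
Proof.
have [x e] := @wo_card_below (@otp (some_wo T) A).
have {e} : A #= below x by rewrite -(card_eql (@card_otp (some_wo T) A)).
move=> e inf.
have := @card_below_sqr _ x; rewrite -(card_le_eqr e) => h.
apply: card_le_trans (h _); last by move=> f; apply: inf; rewrite (eq_finite_set e).
by apply: card_le_setX; rewrite -(card_le_eqr e).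
Qed.

(** * Sets of cardinality less than the cofinality *)

Lemma card_le_bigcup (I T U : choiceType) (D : set I) (F : I -> set T)
    (K : set U) : infinite_set K -> D #<= K ->
  (forall i, D i -> F i #<= K) -> \bigcup_(i in D) F i #<= K.
Proof.
move=> infK DK FK; have [u _] := infinite_setN0 infK.
have [d [dK dinj]] := card_le_fun u DK.
have /choice[h hP] : forall i, exists h : T -> U, D i ->
    (forall x, F i x -> K (h x)) /\
    forall x y, F i x -> F i y -> h x = h y -> x = y.
  move=> i; have [Di|nDi] := pselect (D i); last by exists (fun=> u).
  by have [h ?] := card_le_fun u (FK i Di); exists h.
have [[i0 _]|noI] := pselect (exists i : I, True); last first.
  apply: card_le_trans (card_ge0 _ K); apply: subset_card_le => x [i].
  by case: noI; exists i.
have /choice[j jP] : forall x, exists i, (\bigcup_(i in D) F i) x -> D i /\ F i x.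
  move=> x; have [[i Di Fx]|nx] := pselect ((\bigcup_(i in D) F i) x).
    by exists i.
  by exists i0.
apply: card_le_trans (card_sqr infK).
apply: (@inj_on_le_card _ _ _ _ (fun x => (d (j x), h (j x) x))) => [x|x y].
  by move=> /jP[Dj Fj]; split; [apply: dK | apply: (hP _ Dj).1].
move=> /jP[Dx Fx] /jP[Dy Fy] [/dinj jxy].
by rewrite -jxy // in Fy *; apply: (hP _ Dx).2.
Qed.

Lemma infinite_succ_card (W : woType) :
  infinite_set [set: W] -> infinite_set [set: succ_card W].
Proof.
move=> inf fin; apply: inf; have [x e] := wo_card_below W.
by rewrite (eq_finite_set e); apply: sub_finite_set fin.
Qed.

Lemma card_le_succ (W : woType) : [set: W] #<= [set: succ_card W].
Proof. by have [x e] := wo_card_below W; rewrite (card_le_eql e) card_leT. Qed.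

(** Regularity of successors: if [A] were unbounded, the initial segments below its points would
    cover the successor by at most |W| sets of cardinality at most |W|. *)
Lemma succ_card_bounded (W : woType) (A : set (succ_card W)) :
  infinite_set [set: W] -> A #<= [set: W] -> exists b, forall x, A x -> x <= b.
Proof.
move=> inf AW; apply: contrapT => /forallNP unb.
have [noW le] := succ_card_spec W; apply: noW.
apply: card_le_trans (card_le_bigcup inf AW (fun i _ => le i)).
apply: subset_card_le => x _; have /existsNP[y /not_implyP[Ay /negP]] := unb x.
by rewrite -ltNge => xy; exists y.
Qed.

Lemma le_increasing (V : woType) (u : V -> V) :
  {homo u : x y / x < y} -> forall x, x <= u x.
Proof.
move=> um; elim/wo_ind => x IH; rewrite leNgt; apply/negP => ux.
by have := IH _ ux; rewrite leNgt um.
Qed.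

Section Small.
Variable kappa : woType.

(* The cardinality of A is less than the cofinality of kappa. *)
Definition small (T : Type) (A : set T) : Prop :=
  forall f : T -> kappa, exists b, forall x, A x -> f x <= b.

Lemma small_sub T (A B : set T) : A `<=` B -> small B -> small A.
Proof. by move=> AB sB f; have [b bP] := sB f; exists b => x /AB/bP. Qed.

Lemma small_image T U (g : T -> U) (A : set T) : small A -> small (g @` A).
Proof.
by move=> sA f; have [b bP] := sA (f \o g); exists b => _ [x /bP ? <-].
Qed.

Lemma small_not_cof_le (W : woType) :
  ~ wo_le (cof kappa) W -> small [set: W].
Proof.
move=> nle f; apply: contrapT => /forallNP unb.
have {}unb b : exists w, b <= f w.
  have /existsNP[w /not_implyP[_ /negP]] := unb b.
  by rewrite -ltNge => /ltW; exists w.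
(* The record values of an unbounded [f]: they are cofinal in [kappa], and the positions where they
   first occur increase with them. *)
pose R := [set k | exists2 w, f w = k & forall w', w' < w -> f w' < k].
have Rcof : cofinal R.
  move=> x; have [w xw wmin] := wo_min (unb x).
  exists (f w) => //; exists w => // w' ww'.
  apply: lt_le_trans xw; rewrite ltNge; apply/negP => /wmin.
  by rewrite leNgt ww'.
have [g [gm _]] := (cof_spec kappa).2 _ Rcof.
have /choice[h hP] (k : otp R) : exists w, f w = val k /\
    forall w', w' < w -> f w' < val k.
  by have [w ? ?] := otpP k; exists w.
have hm : {homo h : k k' / k < k'}.
  move=> k k'; rewrite otp_ltE ltNge => kk'; rewrite ltNge.
  apply: contra kk'; rewrite le_eqVlt => /predU1P[e|].
    by rewrite -(hP k).1 -e (hP k').1.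
  by move=> /(hP k).2/ltW; rewrite (hP k').1.
have [//|[x [j [jm rj]]]] := wo_total (cof kappa) W.
have jlt : {mono j : y z / y < z} by apply: leW_mono.
have glt : {mono g : y z / y < z} by apply: leW_mono.
(* If [W] were a proper initial segment of [cof kappa], this would map [cof kappa] increasingly into
   that segment, against [le_increasing]. *)
have um : {homo (fun y => j (h (g y))) : y z / y < z}.
  by move=> y z yz; rewrite jlt; apply: hm; rewrite glt.
have := le_increasing um x; rewrite leNgt.
have : below x (j (h (g x))) by rewrite -rj; exists (h (g x)).
by move=> ->.
Qed.

(** A cofinal set whose order type is the cofinality of [a] is small by [small_not_cof_le], unless
    that cofinality reaches [cof kappa]. These are the two cases of the recursion. *)
Lemma cof_dichotomy (L : woType) (a : L) : wo_le (cof kappa) (cof_at a) \/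
  exists K, [/\ small K, K `<=` below a
                & forall x, x < a -> exists2 y, K y & x <= y].
Proof.
have [|/small_not_cof_le] := pselect (wo_le (cof kappa) (cof_at a)); first by left.
have [[A Acof AE] _] := cof_spec (otp (below a)).
rewrite /cof_at AE => sA; right.
exists [set val (val u) | u in [set: otp A]]; split; first exact: small_image.
  by move=> _ [u _ <-]; apply: otpP.
move=> x xa; have [y Ay] := Acof (SigSub (mem_set (xa : below a x))).
rewrite otp_leE /= => xy; exists (val y) => //.
by exists (SigSub (mem_set Ay)).
Qed.

Hypothesis kinf : infinite_cardinal kappa.

Let kappa0 : exists k : kappa, True.
Proof. by have [k _] := infinite_setN0 kinf.2; exists k. Qed.

Lemma cardinal_no_max (b : kappa) : exists x, b < x.
Proof.
apply: contrapT => /forallNP nx.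
have sub : [set: kappa] `<=` b |` below b.
  move=> x _; have /negP := nx x; rewrite -leNgt le_eqVlt => /predU1P[|];
    by [left|right].
have inf : infinite_set (below b).
  move=> fin; apply: kinf.2; apply: sub_finite_set sub _.
  by rewrite finite_setU; split=> //; apply: finite_set1.
apply: (kinf.1 b).2; apply: card_le_trans (card_le_setU1 b inf).
exact: subset_card_le.
Qed.

(** The regularity of cf kappa: bound [f] on each piece, then bound these bounds over [D]. *)
Lemma small_bigcup I T (D : set I) (F : I -> set T) :
  small D -> (forall i, D i -> small (F i)) -> small (\bigcup_(i in D) F i).
Proof.
move=> sD sF f; have [k0 _] := kappa0.
have /choice[b bP] : forall i, exists b, D i -> forall x, F i x -> f x <= b.
  move=> i; have [Di|nDi] := pselect (D i); last by exists k0.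
  by have [b bP] := sF i Di f; exists b.
have [c cP] := sD b; exists c => x [i Di Fx].
by apply: le_trans (cP i Di); apply: bP.
Qed.

Lemma small_le T U (A : set T) (B : set U) : A #<= B -> small B -> small A.
Proof.
move=> AB sB f; have [k0 _] := kappa0.
have [->|/set0P[t At]] := eqVneq A set0; first by exists k0.
have [u _] : B !=set0.
  apply/set0P/eqP => e; move: AB; rewrite e card_le0 => /eqP A0.
  by move: At; rewrite A0.
have [h [hB hinj]] := card_le_fun u AB.
have /choice[f' f'P] : forall u, exists b, forall x, A x -> h x = u -> f x = b.
  move=> v; have [[x Ax <-]|nx] := pselect (exists2 x, A x & h x = v).
    by exists (f x) => y Ay /(hinj _ _ Ay Ax) ->.
  by exists k0 => x Ax hx; case: nx; exists x.
have [b bP] := sB f'; exists b => x Ax.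
by rewrite (f'P _ x Ax erefl); apply/bP/hB.
Qed.

Lemma small_finite T (A : set T) : finite_set A -> small A.
Proof.
move=> /finite_set_leP[n /small_le]; apply; elim: n => [|n IH] f.
  by have [k0 _] := kappa0; exists k0.
have [b bP] := IH f; exists (Order.max b (f n)) => i /=.
rewrite ltnS leq_eqVlt le_max => /predU1P[->|/bP ->//].
by rewrite lexx orbT.
Qed.

Lemma small_setU T (A A' : set T) :
  small A -> small A' -> small (A `|` A')%classic.
Proof.
move=> sA sA' f; have [b bP] := sA f; have [b' b'P] := sA' f.
exists (Order.max b b') => x [/bP|/b'P]; rewrite le_max => -> //.
by rewrite orbT.
Qed.

Lemma small_set1 T (x : T) : small [set x].
Proof. exact/small_finite/finite_set1. Qed.

Lemma card_ltNge (T : choiceType) (A : set T) :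
  ~ ([set: kappa] #<= A) -> card_lt A [set: kappa].
Proof. by move=> nle; split=> //; have [] := card_le_total A [set: kappa]. Qed.

(** If [kappa] injected into [A], then [kappa] itself would be small and its identity map
    bounded. *)
Lemma small_card_lt (T : choiceType) (A : set T) :
  small A -> card_lt A [set: kappa].
Proof.
move=> sA; apply: card_ltNge => /small_le/(_ sA)/(_ id)[b bP].
by have [x] := cardinal_no_max b; rewrite ltNge bP.
Qed.

Lemma card_lt_le (T U : choiceType) (A : set T) (B : set U) :
  A #<= B -> card_lt B [set: kappa] -> card_lt A [set: kappa].
Proof.
move=> AB [Bk nkB]; split; first exact: card_le_trans Bk.
by move=> kA; apply: nkB; apply: card_le_trans AB.
Qed.

Lemma card_lt_setX (T U : choiceType) (A : set T) (B : set U) :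
  card_lt A [set: kappa] -> card_lt B [set: kappa] ->
  card_lt (A `*` B) [set: kappa].
Proof.
wlog AB : T U A B / A #<= B => [hw|] ltA ltB.
  have [|BA] := card_le_total A B; first by move/hw; apply.
  apply: card_lt_le (hw _ _ _ _ BA ltB ltA).
  by apply: (@inj_on_le_card _ _ _ _ (fun p => (p.2, p.1))) =>
    [p []|[? ?] [? ?] _ _ []-> ->].
have [finB|infB] := pselect (finite_set B); last first.
  apply: card_lt_le ltB; apply: card_le_trans (card_sqr infB).
  exact: card_le_setX.
apply/small_card_lt/small_finite/finite_setX => //.
exact: card_le_finite AB finB.
Qed.

(** For singular [kappa], having fewer than [kappa] elements need not survive unions of fewer than
    [kappa] sets. This stronger condition, relative to a fixed [K] with fewer than [kappa] elements,
    does survive unions indexed by such sets. *)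
Definition small_or_le (U : Type) (K : set U) (T : Type) (A : set T) : Prop :=
  small A \/ A #<= K.

Lemma small_or_le_sub U (K : set U) T (A B : set T) :
  A `<=` B -> small_or_le K B -> small_or_le K A.
Proof.
move=> AB [/(small_sub AB)|BK]; [by left | right].
by apply: card_le_trans BK; apply: subset_card_le.
Qed.

(** The disjunction collapses: if [K] is small, both alternatives mean small; if not, [K] is
    infinite and both give cardinality at most |K|. *)
Lemma small_or_le_bigcup (U I T : choiceType) (K : set U) (D : set I)
    (F : I -> set T) :
  small_or_le K D -> (forall i, D i -> small_or_le K (F i)) ->
  small_or_le K (\bigcup_(i in D) F i).
Proof.
have [sK|nsK] := pselect (small K).
  have sK' T' (A : set T') : small_or_le K A -> small A.
    by case=> // /small_le; apply.
  by move=> /sK' sD sF; left; apply: small_bigcup => // i /sF/sK'.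
have nsK' (T' : choiceType) (A : set T') : small_or_le K A -> A #<= K.
  by case=> // sA; have [|/small_le/(_ sA)] := card_le_total A K.
move=> /nsK' DK FK; right; apply: card_le_bigcup => // [fin|i /FK/nsK' //].
exact/nsK/small_finite.
Qed.

End Small.

(** * The recursion along the square sequence *)

(** The step function receives a total function, equal to the junk value [s0] from [b] on. *)
Lemma wo_rec (W : woType) (S : Type) (s0 : S) (F : W -> (W -> S) -> S) :
  exists g : W -> S, forall b, g b = F b (fun c => if c < b then g c else s0).
Proof.
have wf : well_founded (fun x y : W => x < y).
  by elim/wo_ind => x IH; constructor.
pose G b (rec : forall c, c < b -> S) :=
  F b (fun c => if @idP (c < b) is ReflectT p then rec c p else s0).
exists (Fix wf (fun=> S) G) => b.
rewrite Fix_eq => [|x f g fg]; congr (F _ _); apply/funext => c.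
  by case: {-}_ / idP => [->|/negP/negPf ->].
by case: {-}_ / idP.
Qed.

Lemma wo_least (W : woType) (A : set W) (w : W) :
  A !=set0 -> A (xget w [set x | A x /\ forall y, A y -> x <= y]) /\
    forall y, A y -> xget w [set x | A x /\ forall y, A y -> x <= y] <= y.
Proof. by move=> /wo_min[x Ax xm]; case: xgetP => // /(_ x)[]. Qed.

Section Walk.
Variables (kappa lam : woType).
Let L := succ_card lam.
Variables (d : Order.disp_t) (B : bJoinSemilatticeType d).
Hypothesis kinf : infinite_cardinal kappa.
Hypothesis Bdir : forall A : set B,
  small kappa A -> exists b, forall x, A x -> x <= b.
Variables (eps : lam -> B) (C : L -> set L).

Let big (b : L) := wo_le (cof kappa) (cof_at b).

Hypothesis Cclub : forall b, big b -> club_in (C b) b.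

(* E c X is the coefficient e c of the header, for any b such that c is in C b and
   X is the intersection of C b with c; idx c X is the order type of X. *)
Lemma walk_rec : lam -> exists (r : L -> L -> B) (E : L -> set L -> B)
    (idx : L -> set L -> lam),
  [/\ forall b, r b b = \bot,
      forall b, big b -> forall a, a < b -> exists c,
        [/\ C b c, a <= c, forall c', C b c' -> a <= c' -> c <= c' &
            r a b = E c (cut (C b) c) `|` r a c],
      forall b, ~ big b -> exists K q,
        [/\ small kappa K, K `<=` below b,
            forall c c', K c -> K c' -> r c c' <= q &
            forall a, a < b -> exists2 c, K c /\ a <= c & r a b = q `|` r a c],
      forall b X, X `<=` below b -> eps (idx b X) <= E b X /\
        forall Y, small kappa Y -> Y `<=` X ->
          (forall x, X x -> exists2 z, Y z & x <= z) ->
        exists Z, [/\ Z `<=` X, forall x, X x -> exists2 z, Z z & x <= z &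
            forall z, Z z -> r z b <= E b X /\ E z (cut X z) <= E b X] &
      forall b X, X `<=` below b -> forall y,
        (forall c, X c -> idx c (cut X c) < y) -> idx b X <= y /\
        forall c, X c -> idx c (cut X c) < idx b X].
Proof.
move=> l0.
have /choice[bnd bndP] : forall A : set B, exists b, small kappa A ->
    forall x, A x -> x <= b.
  move=> A; have [/Bdir[b bP]|nA] := pselect (small kappa A); first by exists b.
  by exists \bot.
have /choice[K KP] : forall b : L, exists K, ~ big b -> [/\ small kappa K,
    K `<=` below b & forall x, x < b -> exists2 y, K y & x <= y].
  move=> b; have [?|[K KP]] := cof_dichotomy kappa b; first by exists set0.
  by exists K.
pose Zprop (X Z : set L) := [/\ small kappa Z, Z `<=` X &
  forall x, X x -> exists2 z, Z z & x <= z].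
(* Chosen from [X] alone, so that [E c X] is the same for all clubs with the same trace below [c].
   The default is taken when [X] has no small cofinal subset. *)
pose Zof X : set L := xget set0 [set Z | Zprop X Z].
pose cmin b a := xget b [set x | [set c | C b c /\ a <= c] x /\
   forall c, [set c | C b c /\ a <= c] c -> x <= c].
pose cK b a := xget b [set c | K b c /\ a <= c].
(* The value at [b] consists of the map sending [a] to [r a b], of [E b], and of [idx b]. *)
pose S := ((L -> B) * (set L -> B) * (set L -> lam))%type.
pose kb b (p : L -> S) := bnd [set (p c'.2).1.1 c'.1 | c' in K b `*` K b].
pose row b (p : L -> S) a : B :=
  if a == b then \bot else
  if `[< big b >] then
    (p (cmin b a)).1.2 (cut (C b) (cmin b a)) `|` (p (cmin b a)).1.1 a
  else kb b p `|` (p (cK b a)).1.1 a.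
pose ix (p : L -> S) (X : set L) : lam :=
  let A := [set y | forall c, X c -> (p c).2 (cut X c) < y] in
  xget l0 [set y | A y /\ forall z, A z -> y <= z].
pose F b (p : L -> S) : S := (row b p, fun X => bnd ([set eps (ix p X)] `|`
   ([set row b p z | z in Zof X] `|`
    [set (p z).1.2 (cut X z) | z in Zof X]))%classic,
  ix p).
have [g gE] := wo_rec ((fun=> \bot), (fun=> \bot), (fun=> l0)) F.
pose p b c := if c < b then g c else ((fun=> \bot), (fun=> \bot), (fun=> l0)).
have pE b c : c < b -> p b c = g c by rewrite /p => ->.
have {}gE b : g b = F b (p b) by exact: gE.
exists (fun a b => (g b).1.1 a), (fun b => (g b).1.2), (fun b => (g b).2).
have sZ X : small kappa (Zof X).
  rewrite /Zof; case: xgetP => [Z _ []//|_]; exact/(small_finite kinf)/finite_set0.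
split.
- by move=> b; rewrite gE /= /row eqxx.
- move=> b bb a ab; have [Cb Cc _] := Cclub bb.
  have [|[cC ac] cm] := @wo_least _ [set c | C b c /\ a <= c] b.
    by have [y Cy ay] := Cc _ ab; exists y.
  rewrite -/(cmin b a) in cC ac cm.
  exists (cmin b a); split=> // [c' Cc' ac'|]; first exact: cm.
  by rewrite gE /= /row (lt_eqF ab) (asboolT bb) pE //; apply: Cb.
- move=> b nb; have [sK Kb Kc] := KP b nb; exists (K b), (kb b (p b)); split=> //.
    move=> c c' Kc1 Kc2; apply: bndP.
      apply: small_image.
      have -> : K b `*` K b = \bigcup_(x in K b) [set (x, y) | y in K b].
        apply/seteqP; split=> [[x y] [/= Kx Ky]|_ [x Kx [y Ky <-]]] //.
        by exists x => //; exists y.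
      by apply: small_bigcup => // i _; apply: small_image.
    by exists (c, c') => //=; rewrite pE //; apply: Kb.
  move=> a ab; have [y Ky ay] := Kc _ ab.
  have [Kcm acm] : K b (cK b a) /\ a <= cK b a.
    by rewrite /cK; case: xgetP => // /(_ y)[].
  exists (cK b a) => //.
  by rewrite gE /= /row (lt_eqF ab) (asboolF nb) pE //; apply: Kb.
- move=> b X Xb.
  have sm : small kappa ([set eps (ix (p b) X)] `|`
   ([set row b (p b) z | z in Zof X] `|`
    [set (p b z).1.2 (cut X z) | z in Zof X]))%classic.
    apply: small_setU; first exact: (small_set1 kinf).
    by apply: small_setU; apply: small_image.
  split; first by rewrite gE /=; apply: bndP => //; left.
  move=> Y sY YX Yc.
  have [_ ZX Zc] : Zprop X (Zof X) by rewrite /Zof; case: xgetP => // /(_ Y)[].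
  exists (Zof X); split=> // z Zz; have zb : z < b by apply/Xb/ZX.
  rewrite gE; split; apply: bndP => //; right; first by left; exists z.
  by right; exists z => //; rewrite pE.
- move=> b X Xb y yP.
  have [|Am Amin] :=
      @wo_least _ [set y | forall c, X c -> (p b c).2 (cut X c) < y] l0.
    by exists y => c Xc; rewrite pE; [apply: yP|apply: Xb].
  rewrite gE /=; split.
    by apply: Amin => c Xc; rewrite pE; [apply: yP|apply: Xb].
  by move=> c Xc; have := Am c Xc; rewrite pE //; apply: Xb.
Qed.

End Walk.

(** * Coherence *)

Lemma cutK (W : woType) (X : set W) (a b : W) : a <= b -> cut (cut X b) a = cut X a.
Proof.
move=> ab; apply/seteqP; split=> x [] => [[? _] ?|? xa]; do ?split=> //.
exact: lt_le_trans ab.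
Qed.

(** At a limit point [c] of small cofinality, a small cofinal subset of [c] is pushed up into [C].
    If [c] is not a limit point, the trace of [C] below [c] is empty or, [C] being closed, has a
    maximum. *)
Lemma club_small_cofinal (kappa L : woType) (C : set L) (b c : L) :
  infinite_cardinal kappa -> club_in C b -> C c ->
  (limit_point C c /\ wo_le (cof kappa) (cof_at c)) \/
  exists Y, [/\ small kappa Y, Y `<=` cut C c
              & forall x, cut C c x -> exists2 z, Y z & x <= z].
Proof.
move=> kinf [Cb _ Ccl] Cc.
have [Lc|nL] := pselect (limit_point C c).
  have [bc|[K [sK Kc Kcof]]] := cof_dichotomy kappa c; first by left.
  right; have [_ Lc2] := Lc.
  have /choice[h hP] : forall y, exists z, y < c -> cut C c z /\ y < z.
    move=> y; have [yc|nyc] := pselect (y < c); last by exists y.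
    by have [z Cz /andP[yz zc]] := Lc2 _ yc; exists z.
  exists (h @` K); split; first exact: small_image.
    by move=> _ [y /Kc/hP[? _] <-].
  move=> x [Cx xc]; have [y Ky xy] := Kcof _ xc; exists (h y); first by exists y.
  by apply/ltW/(le_lt_trans xy); apply: (hP _ (Kc _ Ky)).2.
right; have [x0|/forallNP empty] := pselect (exists x, cut C c x); last first.
  exists set0; split=> // [|x /empty //]; exact/(small_finite kinf)/finite_set0.
have [x [xc xP]] : exists x, x < c /\ forall y, cut C c y -> y <= x.
  apply: contrapT => /forallNP nx; apply: nL; split=> [|x xc].
    by have [x [_ xc]] := x0; exists x.
  apply: contrapT => nxy; apply: (nx x); split=> // y [Cy yc].
  by rewrite leNgt; apply/negP => xy; apply: nxy; exists y => //; apply/andP.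
(* The supremum [s] of the trace is below [c]; it lies in [C], as otherwise it would be a limit
   point of [C]. *)
have [|s sub smin] := @wo_min L [set s | forall y, cut C c y -> y <= s].
  by exists x.
have sc : s < c by apply: le_lt_trans xc; apply: smin.
have Cs : C s.
  apply: contrapT => nCs; apply: (nCs); apply: Ccl.
    exact: lt_trans sc (Cb _ Cc).
  have neq y : cut C c y -> y < s.
    move=> Cy; have := sub _ Cy; rewrite le_eqVlt => /predU1P[ys|//].
    by case: nCs; rewrite -ys; apply: Cy.1.
  split=> [|z zs]; first by have [y /neq ys] := x0; exists y.
  apply: contrapT => nz.
  have := smin z; rewrite leNgt zs => /(_ _)/negP; apply=> // y Cy.
  rewrite leNgt; apply/negP => zy; apply: nz; exists y; first exact: Cy.1.
  by rewrite zy neq.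
exists [set s]; split=> [|_ -> //|y /sub]; first exact: small_set1.
by exists s.
Qed.

Section Coherence.
Variables (kappa lam : woType).
Let L := succ_card lam.
Variables (d : Order.disp_t) (B : bJoinSemilatticeType d).
Hypothesis kinf : infinite_cardinal kappa.
Variables (eps : lam -> B) (C : L -> set L).
Hypothesis eps_inj : injective eps.
Let big (b : L) := wo_le (cof kappa) (cof_at b).

Hypothesis Cclub : forall b, big b -> club_in (C b) b.
Hypothesis Cotp : forall b, big b -> wo_le (otp (C b)) lam.
Hypothesis Ccoh : forall b, big b ->
  forall c, limit_point (C b) c -> big c -> C c = cut (C b) c.

Variables (r : L -> L -> B) (E : L -> set L -> B) (idx : L -> set L -> lam).
Hypothesis r_diag : forall b, r b b = \bot.
Hypothesis r_big : forall b, big b -> forall a, a < b -> exists c,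
  [/\ C b c, a <= c, forall c', C b c' -> a <= c' -> c <= c' &
      r a b = E c (cut (C b) c) `|` r a c].
Hypothesis r_small : forall b, ~ big b -> exists K q,
  [/\ small kappa K, K `<=` below b,
      forall c c', K c -> K c' -> r c c' <= q &
      forall a, a < b -> exists2 c, K c /\ a <= c & r a b = q `|` r a c].
Hypothesis E_bound : forall b X, X `<=` below b -> eps (idx b X) <= E b X /\
  forall Y, small kappa Y -> Y `<=` X ->
    (forall x, X x -> exists2 z, Y z & x <= z) ->
  exists Z, [/\ Z `<=` X, forall x, X x -> exists2 z, Z z & x <= z &
      forall z, Z z -> r z b <= E b X /\ E z (cut X z) <= E b X].
Hypothesis idx_least : forall b X, X `<=` below b -> forall y,
  (forall c, X c -> idx c (cut X c) < y) -> idx b X <= y /\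
  forall c, X c -> idx c (cut X c) < idx b X.

Let e b c := E c (cut (C b) c).

(** By the coherence of the square, [C c] is the trace of [C b]: it has the same first point [k]
    above [x], with the same trace below [k], hence the same coefficient. *)
Lemma r_limit b c : big b -> limit_point (C b) c -> big c ->
  forall x k, C b k -> x <= k -> (forall y, C b y -> x <= y -> k <= y) ->
  k < c -> r x c = e b k `|` r x k.
Proof.
move=> bb lc bc x k Ck xk kmin kc.
have CE := Ccoh bb lc bc.
have [k' []] := r_big bc (le_lt_trans xk kc).
rewrite CE => -[Ck' k'c] xk' k'min rE.
have kk' : k' = k by apply: le_anti; rewrite k'min //= kmin.
by rewrite rE /e kk' cutK // ltW.
Qed.

Definition coherent b := forall q a x, x <= a -> a <= b -> r a b <= q ->
  (r x a <= q) = (r x b <= q).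

(** Induction along [C b]. At limit points of large cofinality [r_limit] computes both sides;
    elsewhere [E_bound] supplies a club point [z] in between, and coherence at [c] carries the claim
    from [c] down to [z]. *)
Lemma club_coherent b : big b -> (forall c, c < b -> coherent c) ->
  forall c, C b c -> forall q, e b c <= q -> forall c', C b c' -> c' < c ->
  (e b c' <= q -> r c' c <= q) /\
  forall x, x <= c' -> (forall y, C b y -> x <= y -> c' <= y) ->
    r x c <= q -> e b c' <= q /\ r x c' <= q.
Proof.
move=> bb coh; have [Cb _ _] := Cclub bb.
elim/wo_ind => c IH Cc q ecq c' Cc' c'c.
have [[lc bc]|[Y [sY YX Yc]]] := club_small_cofinal kinf (Cclub bb) Cc.
  split=> [ec'q|x xc' c'min].
    by rewrite (r_limit bb lc bc Cc') // r_diag joinx0.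
  by rewrite (r_limit bb lc bc Cc') // leUx => /andP.
have [_ /(_ _ sY YX Yc)[Z [ZX Zc ZP]]] :=
  @E_bound c (cut (C b) c) (@subIsetr _ _ _).
have [z Zz c'z] := Zc c' (conj Cc' c'c).
have [Cz zc] := ZX _ Zz; have [rz] := ZP _ Zz.
rewrite (cutK _ (ltW zc)) => ez.
have rzq := le_trans rz ecq; have ezq := le_trans ez ecq.
have coc := coh _ (Cb _ Cc).
have := c'z; rewrite le_eqVlt => /predU1P[->|{}c'z].
  by split=> // x xz _ rxc; split=> //; rewrite (coc q z x xz (ltW zc)).
have [IH1 IH2] := IH z zc Cz q ezq c' Cc' c'z.
split=> [/IH1|x xc' c'min rxc]; first by rewrite (coc q z c' (ltW c'z) (ltW zc)).
apply: IH2 => //; rewrite (coc q z x _ (ltW zc)) //.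
exact/ltW/(le_lt_trans xc').
Qed.

Lemma r_coherent b : coherent b.
Proof.
elim/wo_ind: b => b coh q a x xa; rewrite le_eqVlt => /predU1P[-> //|ab] rab.
have xb := le_lt_trans xa ab.
have [bb|nb] := pselect (big b); last first.
  have [K [p [_ Kb Kp rE]]] := r_small nb.
  (* Any point of [K] above [y] may replace the one chosen for [y]: values of [r] on [K] are below
     [p], so coherence at the larger of the two points applies. Then [a] and [x] can share one
     [c]. *)
  have main y : y < b -> forall c, K c -> y <= c ->
      (r y b <= q) = (p <= q) && (r y c <= q).
    move=> yb c Kc yc; have [c' [Kc' yc'] ->] := rE y yb; rewrite leUx.
    apply: andb_id2l => pq; have [cc'|/ltW c'c] := leP c c'.
      by apply/esym/(coh _ (Kb _ Kc')) => //; apply: le_trans pq; apply: Kp.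
    by apply: (coh _ (Kb _ Kc)) => //; apply: le_trans pq; apply: Kp.
  have [c [Kc ac] _] := rE a ab.
  move: rab; rewrite (main a ab c) // => /andP[pq rac].
  rewrite (main x xb c) //; last exact: le_trans ac.
  by rewrite pq /=; apply: coh => //; apply: Kb.
have [Cb _ _] := Cclub bb.
have [c [Cc ac cmin rE]] := r_big bb ab.
have [c' [Cc' xc' c'min ->]] := r_big bb xb.
move: rab; rewrite rE !leUx -!/(e b _) => /andP[ecq rac].
rewrite (coh _ (Cb _ Cc) q a x) //.
(* The first club points above [x] and above [a] may differ; [club_coherent] compares them. *)
have c'c : c' <= c by apply: c'min => //; apply: le_trans ac.
move: c'c; rewrite le_eqVlt => /predU1P[->|c'c]; first by rewrite ecq.
have [H1 H2] := club_coherent bb coh Cc ecq Cc' c'c.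
apply/idP/andP => [/H2[]//|[/H1 rc' rx]].
by rewrite -(coh _ (Cb _ Cc) q c' x xc' (ltW c'c)).
Qed.

(** An embedding of [C b] into [lam] bounds the indices from above, by induction. So the least
    strict upper bounds exist in [lam], and the index strictly increases along [C b]. *)
Lemma idx_inj b : big b -> forall c c', C b c -> C b c' ->
  idx c (cut (C b) c) = idx c' (cut (C b) c') -> c = c'.
Proof.
move=> bb; have [f [fm _]] := Cotp bb.
have flt u v : (u < v) = (f u < f v) by rewrite (leW_mono fm).
have le_f c (Cc : C b c) : idx c (cut (C b) c) <= f (SigSub (mem_set Cc)) /\
    forall c', cut (C b) c c' -> idx c' (cut (C b) c') < idx c (cut (C b) c).
  elim/wo_ind: c Cc => c IH Cc.
  have [|h1 h2] := @idx_least c (cut (C b) c) (@subIsetr _ _ _)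
      (f (SigSub (mem_set Cc))).
    move=> c' [Cc' c'c]; rewrite (cutK _ (ltW c'c)).
    by apply: le_lt_trans (IH _ c'c Cc').1 _; rewrite -flt otp_ltE.
  split=> // c' Cc'; have := h2 _ Cc'; rewrite cutK //; exact/ltW/Cc'.2.
move=> c c' Cc Cc' ee; case: (ltgtP c c') => // h.
  by have := (le_f c' Cc').2 c (conj Cc h); rewrite ee ltxx.
by have := (le_f c Cc).2 c' (conj Cc' h); rewrite ee ltxx.
Qed.

(** A point [a < b] of this set has [r a c <= q] for some [c] taken from a small set or from the
    club points with coefficient below [q]. Their labels are distinct and below [q], so there are at
    most as many as elements below [q]; induction and [small_or_le_bigcup] conclude. *)
Lemma r_ideal b q :
  small_or_le kappa [set p | p <= q] [set a | a <= b /\ r a b <= q].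
Proof.
elim/wo_ind: b => b IH.
have U1 (A : set L) (D : set L) : small_or_le kappa [set p | p <= q] D ->
    D `<=` below b ->
    (forall a, A a -> a = b \/ exists2 c, D c & a <= c /\ r a c <= q) ->
    small_or_le kappa [set p | p <= q] A.
  move=> sD Db AP.
  apply: (@small_or_le_sub _ _ _ _ _ (\bigcup_(i in [set: bool])
     if i then [set b] else \bigcup_(c in D) [set a | a <= c /\ r a c <= q])).
    by move=> a /AP[->|[c Dc ?]]; [exists true | exists false => //; exists c].
  apply: (small_or_le_bigcup kinf) => [|[] _].
  - by left; apply/(small_finite kinf)/finite_finset.
  - by left; apply: small_set1.
  - by apply: (small_or_le_bigcup kinf) => // c /Db/IH.
have [bb|nb] := pselect (big b); last first.
  have [K [p [sK Kb Kp rE]]] := r_small nb.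
  apply: (U1 _ K) => //; first by left.
  move=> a [ab]; move: ab; rewrite le_eqVlt => /predU1P[|ab]; first by left.
  by have [c [Kc ac] ->] := rE a ab; rewrite leUx => /andP[_ rac]; right; exists c.
have [Cb _ _] := Cclub bb.
apply: (U1 _ [set c | C b c /\ e b c <= q]) => [|c [/Cb]//|].
  right; apply: (@inj_on_le_card _ _ _ _ (fun c => eps (idx c (cut (C b) c)))) =>
    [c [_]|].
    by apply: le_trans; apply: (E_bound (@subIsetr _ _ _)).1.
  by move=> c c' [Cc _] [Cc' _] /eps_inj/(idx_inj bb Cc Cc').
move=> a [ab]; move: ab; rewrite le_eqVlt => /predU1P[|ab]; first by left.
have [c [Cc ac _ ->]] := r_big bb ab; rewrite leUx => /andP[ec rac].
by right; exists c.
Qed.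

End Coherence.

(** Each subadditivity is coherence with [q] equal to the right-hand side. *)
Lemma square_subadditive (kappa lam : woType) d (B : bJoinSemilatticeType d)
    (eps : lam -> B) :
  infinite_cardinal kappa -> square lam (cof kappa) -> lam ->
  (forall A : set B, small kappa A -> exists b, forall x, A x -> x <= b) ->
  (forall q : B, card_lt [set p | p <= q] [set: kappa]) ->
  injective eps ->
  exists r : succ_card lam -> succ_card lam -> B,
    [/\ forall a, r a a = \bot,
        forall a b c, a <= b -> b <= c -> r a c <= r a b `|` r b c,
        forall a b c, a <= b -> b <= c -> r a b <= r a c `|` r b c &
        forall b q, card_lt [set a | a <= b /\ r a b <= q] [set: kappa]].
Proof.
move=> kinf [C CP] l0 Bdir Bid eps_inj.
have Cclub b : wo_le (cof kappa) (cof_at b) -> club_in (C b) b by case/CP.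
have Cotp b : wo_le (cof kappa) (cof_at b) -> wo_le (otp (C b)) lam by case/CP.
have Ccoh b : wo_le (cof kappa) (cof_at b) -> forall c, limit_point (C b) c ->
    wo_le (cof kappa) (cof_at c) -> C c = cut (C b) c by case/CP.
have [r [E [idx [r1 r2 r3 r4 r5]]]] := walk_rec kinf Bdir eps Cclub l0.
have coh := r_coherent kinf Cclub Ccoh r1 r2 r3 r4.
exists r; split=> // [a b c ab bc|a b c ab bc|b q].
- by rewrite -(coh c _ b a) // ?leUl ?leUr.
- by rewrite (coh c _ b a) // ?leUl ?leUr.
have [|le] := r_ideal kinf eps_inj Cclub Cotp r2 r3 r4 r5 b q.
  exact: small_card_lt.
exact: card_lt_le le (Bid q).
Qed.

(** * Semilattices from subadditive maps *)

(** [sm_subadd1] makes the order on pairs transitive and [tri_join] an upper bound; [sm_subadd2]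
    makes that bound least. *)
Record subadd_map (gamma : woType) d (B : bJoinSemilatticeType d) := SubaddMap {
  sm_fun :> gamma -> gamma -> B;
  sm_zero : gamma;
  sm_sym : forall a b, sm_fun a b = sm_fun b a;
  sm_diag : forall a, sm_fun a a = \bot;
  sm_zero_le : forall a, sm_zero <= a;
  sm_zeroE : forall a, sm_fun sm_zero a = \bot;
  sm_subadd1 : forall a b c, a <= b -> b <= c ->
    sm_fun a c <= sm_fun a b `|` sm_fun b c;
  sm_subadd2 : forall a b c, a <= b -> b <= c ->
    sm_fun a b <= sm_fun a c `|` sm_fun b c }.

Section Tri.
Variables (gamma : woType) (d : Order.disp_t) (B : bJoinSemilatticeType d).
Variable R : subadd_map gamma B.

(** The map is recorded in the type, so that each [R] carries its own order on the product. *)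
Definition tri_sort of subadd_map gamma B : Type := (gamma * B)%type.
Local Notation tri := (tri_sort R).

HB.instance Definition _ := Choice.on tri.

Let le (u v : tri) := tri_le R u v.

Fact tri_le_refl : reflexive le.
Proof. by move=> [a p]; rewrite /le /tri_le /= lexx sm_diag joinx0 lexx. Qed.

Fact tri_le_anti : antisymmetric le.
Proof.
move=> [a p] [b q] /andP[/andP[/= ab pq] /andP[/= ba qp]].
have {ba}-> : b = a by apply: le_anti; rewrite ab ba.
move: pq qp; rewrite !leUx => /andP[pq _] /andP[qp _].
by congr pair; apply: le_anti; rewrite pq.
Qed.

Fact tri_le_trans : transitive le.
Proof.
move=> [b q] [a p] [c s] /andP[/= ab pq] /andP[/= bc qs].
rewrite /le /tri_le /= (le_trans ab bc) /=.
move: pq qs; rewrite !leUx => /andP[pq rab] /andP[qs rbc].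
rewrite (le_trans pq qs) /= (le_trans (sm_subadd1 R ab bc)) // leUx rbc.
by rewrite (le_trans rab qs).
Qed.

HB.instance Definition _ := Order.Le_isPOrder.Build (Order.Disp tt tt) tri
  tri_le_refl tri_le_anti tri_le_trans.

Lemma tri_leE (u v : tri) : (u <= v) = tri_le R u v.
Proof. by []. Qed.

Definition tri_join (u v : tri) : tri :=
  (Order.max u.1 v.1, u.2 `|` v.2 `|` R u.1 v.1).

Fact tri_joinP (u v w : tri) :
  (tri_join u v <= w) = (u <= w) && (v <= w).
Proof.
wlog ab : u v / u.1 <= v.1.
  move=> hw; have [/hw //|/ltW/hw] := leP u.1 v.1.
  by rewrite andbC /tri_join maxC [R v.1 _]sm_sym [v.2 `|` _]joinC.
case: u v w ab => [a p] [b q] [c s] /= ab.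
rewrite !tri_leE /tri_le /tri_join /= (max_idPr ab) !leUx.
have [bc|] := boolP (b <= c); last by rewrite andbF.
rewrite (le_trans ab bc) /=; apply/idP/idP.
  move=> /andP[/andP[/andP[-> ->] rab] rbc]; rewrite rbc !andbT /=.
  by apply: le_trans (sm_subadd1 R ab bc) _; rewrite leUx rab.
move=> /andP[/andP[-> rac] /andP[-> rbc]]; rewrite rbc !andbT /=.
by apply: le_trans (sm_subadd2 R ab bc) _; rewrite leUx rac.
Qed.

HB.instance Definition _ := Order.POrder_isJoinSemilattice.Build
  (Order.Disp tt tt) tri tri_joinP.

Fact tri_bot_le (u : tri) : ((sm_zero R, \bot) : tri) <= u.
Proof.
by rewrite tri_leE /tri_le /= sm_zero_le sm_zeroE joinxx le0x.
Qed.

HB.instance Definition _ :=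
  Order.hasBottom.Build (Order.Disp tt tt) tri tri_bot_le.

Lemma tri_joinE (u v : tri) : u `|` v = tri_join u v.
Proof. by []. Qed.

(** First bound the first coordinates by some [b], then the second coordinates joined with the
    values of [R] at [b]. *)
Lemma tri_directed (kappa : woType) :
  (forall A : set gamma, small kappa A -> exists b, forall x, A x -> x <= b) ->
  (forall A : set B, small kappa A -> exists b, forall x, A x -> x <= b) ->
  forall A : set tri, small kappa A -> exists b, forall x, A x -> x <= b.
Proof.
move=> gdir Bdir A sA.
have [b bP] := gdir _ (small_image fst sA).
have [q qP] := Bdir _ (small_image (fun u => u.2 `|` R u.1 b) sA).
exists (b, q) => u Au; rewrite tri_leE /tri_le /= bP /=; last by exists u.
by apply: qP; exists u.
Qed.

(* Of the elements of a flat top in [gamma * B], at most one has its first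
   coordinate below that of the top; the others yield a flat top in [B]. *)
Lemma tri_flat_top_free k : flat_top_free k B -> flat_top_free k.+1 tri.
Proof.
move=> free [f [finj fmorph]]; apply: free.
have [i0 i0P] : exists i0, forall j, j != i0 -> (f (Some j)).1 = (f None).1.
  have [[i ni]|all1] := pselect (exists i, (f (Some i)).1 <> (f None).1).
    exists i => j ji; have /(congr1 fst) := fmorph (Some j) (Some i).
    rewrite {1}/Order.join /= /flat_top_join (inj_eq Some_inj) (negPf ji) => e.
    by move: ni; rewrite e /= maxEle; case: ifP.
  by exists ord0 => j _; apply: contrapT => nj; apply: all1; exists j.
pose phi (x : flat_top 'I_k) : flat_top 'I_k.+1 := omap (lift i0) x.
have phi_inj : injective phi by move=> [x|] [y|] //= /Some_inj/lift_inj ->.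
have phi1 x : (f (phi x)).1 = (f None).1.
  by case: x => [x|//]; apply: i0P; rewrite eq_sym neq_lift.
(* The first coordinate is constant on the image of [phi], so the second one determines the point,
   and [R] contributes only [\bot] to joins. *)
exists (fun x => (f (phi x)).2); split=> [x y exy|x y].
  apply/phi_inj/finj; move: exy (phi1 x) (phi1 y).
  by case: (f (phi x)) (f (phi y)) => [a p] [b q] /= -> -> ->.
have -> : phi (x `|` y) = phi x `|` phi y.
  rewrite /Order.join /= /flat_top_join (inj_eq phi_inj).
  by case: ifP.
by rewrite fmorph tri_joinE /= !phi1 sm_diag joinx0.
Qed.

Lemma tri_special (n : nat) (kappa : woType) : infinite_cardinal kappa ->
  special_semiladder n kappa B -> flat_top_free n.+1 B ->
  (forall q : B, card_lt [set p | p <= q] [set: kappa]) ->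
  (forall b q, card_lt [set a | a <= b /\ R a b <= q] [set: kappa]) ->
  special_semiladder n.+1 kappa tri.
Proof.
move=> kinf spec free Bid Rid; split.
  split; first by exists \bot.
    exact: tri_flat_top_free.
  move=> [b q]; apply: card_lt_le (card_lt_setX kinf (Rid b q) (Bid q)).
  apply: subset_card_le => -[a p] /andP[/= ab].
  by rewrite leUx => /andP[pq rab].
exists gamma, d, B, R, id; split=> //.
  by split; [apply: sm_sym|apply: sm_diag].
  move=> z zle a; have -> : z = sm_zero R by apply: le_anti; rewrite zle sm_zero_le.
  exact: sm_zeroE.
by exists id.
Qed.

End Tri.

(** * Induction on the number of successors *)

Section Extension.
Variables (kappa : woType) (kinf : infinite_cardinal kappa).

Lemma card_lt_setU1 (T : choiceType) (A : set T) x :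
  card_lt A [set: kappa] -> card_lt (x |` A)%classic [set: kappa].
Proof.
move=> ltA; have [finA|infA] := pselect (finite_set A).
  apply/(small_card_lt kinf)/(small_finite kinf).
  by rewrite finite_setU; split=> //; apply: finite_set1.
by apply: card_lt_le ltA; apply: card_le_setU1.
Qed.

Lemma infinite_iter_succ n : infinite_set [set: iter n succ_card kappa].
Proof. elim: n => [|n IH]; [exact: kinf.2 | exact: infinite_succ_card]. Qed.

Lemma card_le_iter_succ n : [set: kappa] #<= [set: iter n succ_card kappa].
Proof. by elim: n => [//|n IH]; apply: card_le_trans (card_le_succ _). Qed.

(** The map from the square is symmetrized and reset to [\bot] at the least point [z]. Both
    subadditivities survive, and the sets to be counted gain at most the point [z]. *)
Lemma square_subadd_map n d (B : bJoinSemilatticeType d) :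
  square (iter n succ_card kappa) (cof kappa) ->
  (forall A : set B, small kappa A -> exists b, forall x, A x -> x <= b) ->
  (forall q : B, card_lt [set p | p <= q] [set: kappa]) ->
  [set: iter n succ_card kappa] #<= [set: B] ->
  exists R : subadd_map (iter n.+1 succ_card kappa) B,
    forall b q, card_lt [set a | a <= b /\ R a b <= q] [set: kappa].
Proof.
move=> sq Bdir Bid /card_le_funT[eps _ eps_inj].
have [l0 _] := infinite_setN0 (@infinite_iter_succ n).
have [r [r_diag r1 r2 rid]] := square_subadditive kinf sq l0 Bdir Bid eps_inj.
have [z _ zle] := @wo_min (iter n.+1 succ_card kappa) _
  (infinite_setN0 (@infinite_iter_succ n.+1)).
have {}zle a : z <= a by apply: zle.
pose rho (a b : iter n.+1 succ_card kappa) : B :=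
  if (a == z) || (b == z) then \bot else r (Order.min a b) (Order.max a b).
have rhoz a : rho z a = \bot by rewrite /rho eqxx.
have rhoE a b : a != z -> a <= b -> rho a b = r a b.
  move=> az ab; rewrite /rho (negPf az) (min_idPl ab) (max_idPr ab) ifF //.
  by apply/negP => /eqP bz; move: az; rewrite eq_le zle -bz ab.
have nz a b : a != z -> a <= b -> b != z.
  by move=> az ab; apply: contra az => /eqP bz; rewrite eq_le zle -bz ab.
have sym a b : rho a b = rho b a by rewrite /rho orbC minC maxC.
have diag a : rho a a = \bot by rewrite /rho orbb minxx maxxx r_diag if_same.
have sub1 a b c : a <= b -> b <= c -> rho a c <= rho a b `|` rho b c.
  move=> ab bc; have [->|az] := eqVneq a z; first by rewrite rhoz le0x.
  by rewrite !rhoE ?(nz a b) ?(le_trans ab bc) //; apply: r1.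
have sub2 a b c : a <= b -> b <= c -> rho a b <= rho a c `|` rho b c.
  move=> ab bc; have [->|az] := eqVneq a z; first by rewrite rhoz le0x.
  by rewrite !rhoE ?(nz a b) ?(le_trans ab bc) //; apply: r2.
exists (SubaddMap sym diag zle rhoz sub1 sub2) => b q /=.
apply: card_lt_le (card_lt_setU1 z (rid b q)).
apply: subset_card_le => a [ab]; have [->|az] := eqVneq a z; first by left.
by rewrite rhoE // => rab; right.
Qed.

Lemma succ_small_bounded n (A : set (iter n.+1 succ_card kappa)) :
  small kappa A -> exists b, forall x, A x -> x <= b.
Proof.
move=> /(small_card_lt kinf)[Ak _].
apply: succ_card_bounded; first exact: infinite_iter_succ.
exact: card_le_trans (card_le_iter_succ n).
Qed.

(** The bound on small sets is carried along because building the next map requires it. *)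
Lemma directed_special_semiladder n :
  (forall m, (m < n)%N -> square (iter m succ_card kappa) (cof kappa)) ->
  exists d (S : bJoinSemilatticeType d), [/\ special_semiladder n.+1 kappa S,
    forall A : set S, small kappa A -> exists b, forall x, A x -> x <= b &
    [set: S] #= [set: iter n succ_card kappa]].
Proof.
elim: n => [_|n IH sq].
  have [z _ zle] := wo_min (infinite_setN0 kinf.2).
  have ltB (T : finType) (A : set T) : card_lt A [set: kappa].
    exact/(small_card_lt kinf)/(small_finite kinf)/finite_finset.
  (* Empty tuples give a one-point semilattice. With the zero map on [kappa], principal ideals are
     proper initial segments of [kappa]. *)
  pose triv : bJoinSemilatticeType _ := 0.-tuplelexi bool.
  have trivE (x y : triv) : x = y by rewrite [x]tuple0 [y]tuple0.
  have R0 : subadd_map kappa triv.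
    by exists (fun _ _ => \bot) z => // *; rewrite ?le0x //; apply: zle.
  exists _, (tri_sort R0); split.
  - apply: tri_special => // [|q|b q].
    - by move=> [f [finj _]]; have /finj := trivE (f None) (f (Some ord0)).
    - exact: ltB.
    - apply: card_lt_le (card_lt_setU1 b (kinf.1 b)).
      apply: subset_card_le => a []; rewrite le_eqVlt.
      by move=> /predU1P[->|?] _; [left|right].
  - by apply: tri_directed => // A _; exists \bot => x _; rewrite (trivE x \bot).
  - apply/card_eqPle; split.
      apply: (@inj_on_le_card _ _ _ _ fst) => // -[a p] [b q] _ _ /= ->.
      by rewrite (trivE p q).
    apply: (@inj_on_le_card _ _ _ _ (fun a => (a, \bot) : tri_sort R0)) => //.
    by move=> a b _ _ [].
have [d [S [spec Sdir cardS]]] := IH (fun m mn => sq m (ltnW mn)).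
have [[_ free Sid] _] := spec.
have [cardSle cardSge] := (card_eqPle _ _).1 cardS.
have [R Rid] := square_subadd_map (sq n (ltnSn n)) Sdir Sid cardSge.
exists _, (tri_sort R); split.
- exact: tri_special.
- by apply: tri_directed => //; apply: succ_small_bounded.
- apply/card_eqPle; split; last first.
    apply: (@inj_on_le_card _ _ _ _ (fun a => (a, \bot) : tri_sort R)) => //.
    by move=> a b _ _ [].
  apply: card_le_trans (card_sqr (@infinite_iter_succ n.+1)).
  rewrite -[X in X #<= _]/([set: _ * _]) -setXTT.
  apply: card_le_setX => //; apply: card_le_trans cardSle _.
  exact: card_le_succ.
Qed.

End Extension.

Theorem theorem6p1 (kappa : woType) (n : nat)
    (hkappa : infinite_cardinal kappa)
    (hsquare : forall m : nat, (m < n)%N ->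
       square (iter m succ_card kappa) (cof kappa)) :
  exists (d : Order.disp_t) (S : bJoinSemilatticeType d),
    special_semiladder n.+1 kappa S /\
    ([set: S] #= [set: iter n succ_card kappa])%card.
Proof.
have [d [S [spec _ cardS]]] := directed_special_semiladder hkappa hsquare.
by exists d, S.
Qed.
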